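(* For all integers $k\ge 1$ and all integers $m,n\ge 0$, $$\mathcal{L}(\mathrm{PD}_k)_{m,n} = \mathrm{PD}_k(m,n)^2-\mathrm{PD}_k(m,n-1)\,\mathrm{PD}_k(m,n+1)=\mathrm{PD}_{k-1}(m,n)\cdot \mathrm{PD}_{k+1}(m,n).$$ In array notation, $\mathcal{L}(\mathrm{PD}_k)=\mathrm{PD}_{k-1}\odot \mathrm{PD}_{k+1}$.
   Context: Let $P=(P_{a,b})_{a,b\ge 0}$ be the lower-triangular Pascal matrix, $P_{a,b}=\binom{a}{b}$, with $\binom{a}{b}=0$ if $b>a$ or $b<0$. For each integer $k\ge 1$ and all $i,j\ge 0$, the Pascal determinantal array of order $k$ is $\mathrm{PD}_k(i,j)=\det\bigl(\binom{i+r}{j+s}\bigr)_{0\le r,s\le k-1}$. By convention $\mathrm{PD}_0(i,j)=1$ for all $i,j\ge 0$. The log-concavity operator $\mathcal{L}$ acts row-wise on an array $A=(a_{i,j})_{i,j\ge 0}$ by $\mathcal{L}(A)_{i,j}=a_{i,j}^2-a_{i,j-1}a_{i,j+1}$, where terms with negative or out-of-range indices are taken to be zero (so for $k\ge 1$, $\mathrm{PD}_k(m,-1)=0$). The symbol $\odot$ denotes the Hadamard (entrywise) product of arrays. *)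

(* Defs.v *)
From HB Require Import structures.
From mathcomp Require Import all_boot all_order all_algebra.

Set Implicit Arguments.
Unset Strict Implicit.
Unset Printing Implicit Defensive.

Import GRing.Theory.
Local Open Scope ring_scope.

Definition array (R : Type) := nat -> nat -> R.

(* Extension of an array by zero to all integer indices. *)
Definition entry (R : pzRingType) (A : array R) (i j : int) : R :=
  if (i, j) is (Posz i', Posz j') then A i' j' else 0.

Definition logconc (R : pzRingType) (A : array R) : array R :=
  fun i j => entry A i j ^+ 2 - entry A i (j%:Z - 1) * entry A i (j%:Z + 1).

Definition hadamard (R : pzRingType) (A B : array R) : array R :=
  fun i j => A i j * B i j.

(* The determinant of the empty matrix is 1, so PD 0 is constantly 1. *)
Definition PD (k : nat) : array int :=
  fun i j => \det (\matrix_(r < k, s < k) ('C(i + r, j + s)%N)%:Z).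

Lemma PD0 (i j : nat) : PD 0 i j = 1.
Proof. exact: det_mx00. Qed.

(* Main.v *)
Require Import Defs.
From HB Require Import structures.
From mathcomp Require Import all_boot all_order all_algebra.
From mathcomp Require Import zify.

(** Row operations turn the Pascal minor [PD k i j] into the Toeplitz
determinant with entries [binom i (j + s - r)]; by Vandermonde's identity this
is multiplication by a unitriangular matrix.  All corner minors of a Toeplitz
matrix are again Toeplitz, so the Desnanot-Jacobi identity becomes the claimed
quadratic recurrence. *)

Set Implicit Arguments.
Unset Strict Implicit.
Unset Printing Implicit Defensive.

Import GRing.Theory.
Local Open Scope ring_scope.

Section DesnanotJacobi.

Variable R : comNzRingType.

(** Row [ord0] can be nonzero only in the two corner columns. Expanding each of the two resulting
    minors along its last row leaves an identity matrix, so only the 2 by 2 corner minor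
    survives. *)
Lemma det_replace_corner_cols n (u w : 'cV[R]_n.+2) :
  \det (\matrix_(i, j) if j == ord0 then u i 0
                       else if j == ord_max then w i 0 else (i == j)%:R) =
  u ord0 0 * w ord_max 0 - w ord0 0 * u ord_max 0.
Proof.
set B := \matrix_(i, j) _.
have l0M : lift ord0 ord_max = ord_max :> 'I_n.+2 by apply: val_inj.
have lM0 : lift ord_max ord0 = ord0 :> 'I_n.+2 by apply: val_inj.
have lM (j : 'I_n) : lift ord_max (lift ord0 j) = lift ord0 (lift ord_max j).
  by apply: val_inj; rewrite /= /bump; have := ltn_ord j; lia.
have wM m (j : 'I_m) : widen_ord (leqnSn m) j = lift ord_max j.
  by apply: val_inj; rewrite /= /bump leqNgt ltn_ord.
have mid0 (j : 'I_n) : (ord0 == lift ord0 (lift ord_max j)) = false by [].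
have midM (j : 'I_n) : (ord_max == lift ord0 (lift ord_max j)) = false.
  by rewrite -[X in X == _]l0M (inj_eq lift_inj) (negPf (neq_lift _ _)).
have B0 i : B i ord0 = u i 0 by rewrite mxE.
have BM i : B i ord_max = w i 0 by rewrite mxE eqxx.
have BI i (j : 'I_n) : B i (lift ord0 (lift ord_max j)) =
    (i == lift ord0 (lift ord_max j))%:R.
  by rewrite mxE ![lift _ _ == ord0]eq_sym ![lift _ _ == ord_max]eq_sym mid0 midM.
(* Forgetting the body of [B] keeps [mxE] from unfolding it below. *)
move: B B0 BM BI => B B0 BM BI.
rewrite (expand_det_row _ ord0) big_ord_recl big_ord_recr /= l0M B0 BM.
rewrite big1 ?add0r => [|j _]; last by rewrite wM BI mid0 mul0r.
rewrite /cofactor (expand_det_row (row' ord0 (col' ord0 B)) ord_max).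
rewrite big_ord_recr /= big1 ?add0r => [|j _]; last first.
  by rewrite wM !mxE BI l0M midM mul0r.
rewrite /cofactor (expand_det_row (row' ord0 (col' ord_max B)) ord_max).
rewrite big_ord_recl /= big1 ?addr0 => [|j _]; last first.
  by rewrite !mxE lM BI l0M midM mul0r.
rewrite !mxE l0M lM0 B0 BM /cofactor.
have -> : row' ord_max (col' ord_max (row' ord0 (col' ord0 B))) = 1%:M.
  apply/matrixP => i j.
  by rewrite !mxE BI !(inj_eq lift_inj).
have -> : row' ord_max (col' ord0 (row' ord0 (col' ord_max B))) = 1%:M.
  apply/matrixP => i j.
  by rewrite !mxE lM BI !(inj_eq lift_inj).
(* Signs: the first product carries $(-1)^{n+n} = 1$, the second $(-1)^{n+1}(-1)^n = -1$. *)
rewrite det1 !mulr1 !add0n addn0 expr0 mul1r exprS mulN1r mulrA addnn /=.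
rewrite -[(-1) ^+ n.*2]signr_odd odd_double mulr1 mulrA mulrACA.
by rewrite mulNr -expr2 sqrr_sign mulrN1.
Qed.

(* Multiply [A] by the identity matrix whose corner columns are those of the
   adjugate of [A]. *)
Lemma desnanot_jacobi_mul_det n (A : 'M[R]_n.+2) :
  \det A * (\det (row' ord0 (col' ord0 A)) *
              \det (row' ord_max (col' ord_max A))
            - \det (row' ord_max (col' ord0 A)) *
              \det (row' ord0 (col' ord_max A))) =
  \det A * (\det A * \det (row' ord_max (col' ord_max
                              (row' ord0 (col' ord0 A))))).
Proof.
have := det_replace_corner_cols (col ord0 (\adj A)) (col ord_max (\adj A)).
set B := \matrix_(i, j) _ => detB.
have AB : A *m B = \matrix_(i, j) if j == ord0 then \det A *+ (i == ord0)
    else if j == ord_max then \det A *+ (i == ord_max) else A i j.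
  apply/matrixP => i j; rewrite [RHS]mxE.
  have adjE k : (A *m \adj A) i k = \det A *+ (i == k).
    by rewrite mul_mx_adj mxE.
  case: ifP => [/eqP-> | j0].
    by rewrite -adjE !mxE; apply: eq_bigr => l _; rewrite !mxE.
  case: ifP => [/eqP-> | jM].
    by rewrite -adjE !mxE; apply: eq_bigr => l _; rewrite !mxE eqxx.
  rewrite mxE (bigD1 j) //= big1 ?addr0 => [|l /negPf lj].
    by rewrite mxE j0 jM eqxx mulr1.
  by rewrite mxE j0 jM lj mulr0.
have l0M : lift ord0 ord_max = ord_max :> 'I_n.+2 by apply: val_inj.
(* Each corner column of [A *m B] is [\det A] times a unit vector; expanding along both leaves the
   interior minor. *)
have detAB : \det (A *m B) = \det A * (\det A * \det (row' ord_max (col' ord_max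
                              (row' ord0 (col' ord0 A))))).
  rewrite AB (expand_det_col _ ord0) (bigD1 ord0) //= big1 ?addr0; last first.
    by move=> i /negPf i0; rewrite mxE eqxx i0 mulr0n mul0r.
  rewrite mxE !eqxx mulr1n /cofactor expr0 mul1r; congr (_ * _).
  rewrite (expand_det_col _ ord_max) (bigD1 ord_max) //= big1 ?addr0; last first.
    move=> i /negPf iM; rewrite !mxE l0M /= eqxx.
    by rewrite -l0M (inj_eq lift_inj) iM mulr0n mul0r.
  rewrite !mxE l0M /= eqxx mulr1n /cofactor -signr_odd oddD addbb expr0 mul1r.
  congr (_ * \det _); apply/matrixP => i j; rewrite !mxE /=.
  by rewrite -l0M (inj_eq lift_inj) eq_sym (negPf (neq_lift _ _)).
(* The corner entries of the adjugate are cofactors; the two off-diagonal ones share the sign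
   $(-1)^{n+1}$, which squares to 1. *)
rewrite -detAB det_mulmx detB !mxE /cofactor.
rewrite add0n addn0 addnn -[(-1) ^+ (_).*2]signr_odd odd_double !expr0 !mul1r.
congr (_ * (_ - _)); rewrite mulrACA -expr2 sqrr_sign mul1r.
by [].
Qed.

End DesnanotJacobi.

(* [det A] may be a zero divisor; the determinant of ['X + A] is monic, so it
   can be cancelled before specialising ['X] to [0]. *)
Lemma desnanot_jacobi (R : comNzRingType) n (A : 'M[R]_n.+2) :
  \det A * \det (row' ord_max (col' ord_max (row' ord0 (col' ord0 A)))) =
  \det (row' ord0 (col' ord0 A)) * \det (row' ord_max (col' ord_max A))
  - \det (row' ord_max (col' ord0 A)) * \det (row' ord0 (col' ord_max A)).
Proof.
pose P := char_poly_mx (- A).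
have regP : GRing.lreg (\det P).
  by apply: lreg_lead; rewrite (monicP (char_poly_monic _)); apply: lreg1.
have mapP : map_mx (horner_eval 0) P = A.
  apply/matrixP => i j; rewrite !mxE /horner_eval hornerD hornerN hornerMn.
  by rewrite hornerX hornerC mul0rn add0r opprK.
have /regP /(congr1 (horner_eval 0)) := desnanot_jacobi_mul_det P.
have map_minor m (M : 'M[{poly R}]_m.+1) i j :
    map_mx (horner_eval 0) (row' i (col' j M)) =
    row' i (col' j (map_mx (horner_eval 0) M)).
  by apply/matrixP => k l; rewrite !mxE.
by rewrite rmorphB !rmorphM /= -!det_map_mx !map_minor mapP => ->.
Qed.

(** The parameter [z] is the index on the main diagonal; indices are integers since they can turn
    negative below it. *)
Definition toeplitz (R : Type) (a : int -> R) k (z : int) : 'M[R]_k :=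
  \matrix_(r, s) a (z + s%:Z - r%:Z).

(** Deleting a row and a column at the same end keeps the diagonal index [z]; deleting them at
    opposite ends shifts it by one, up when the first column goes and down when the first row
    goes. *)
Lemma det_toeplitz_rec (R : comNzRingType) (a : int -> R) k (z : int) :
  \det (toeplitz a k.+2 z) * \det (toeplitz a k z) =
  \det (toeplitz a k.+1 z) ^+ 2
  - \det (toeplitz a k.+1 (z - 1)) * \det (toeplitz a k.+1 (z + 1)).
Proof.
have := desnanot_jacobi (toeplitz a k.+2 z).
have bM m (i : 'I_m) : bump m i = i by rewrite /bump leqNgt ltn_ord.
have -> : row' ord0 (col' ord0 (toeplitz a k.+2 z)) = toeplitz a k.+1 z.
  by apply/matrixP => i j; rewrite !mxE /= /bump /=; congr a; lia.
have -> : row' ord_max (col' ord_max (toeplitz a k.+1 z)) = toeplitz a k z.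
  by apply/matrixP => i j; rewrite !mxE /= !bM.
have -> : row' ord_max (col' ord_max (toeplitz a k.+2 z)) = toeplitz a k.+1 z.
  by apply/matrixP => i j; rewrite !mxE /= !bM.
have -> : row' ord_max (col' ord0 (toeplitz a k.+2 z)) = toeplitz a k.+1 (z + 1).
  by apply/matrixP => i j; rewrite !mxE /= bM /bump /=; congr a; lia.
have -> : row' ord0 (col' ord_max (toeplitz a k.+2 z)) = toeplitz a k.+1 (z - 1).
  by apply/matrixP => i j; rewrite !mxE /= bM /bump /=; congr a; lia.
by move=> ->; rewrite expr2 [X in _ - X]mulrC.
Qed.

(** Extension by zero makes Pascal's rule hold at every integer, including $z = 0$. *)
Definition binomz (m : nat) (z : int) : int :=
  if z is Posz n then ('C(m, n))%:Z else 0.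

Lemma binomzS m z : binomz m.+1 z = binomz m z + binomz m (z - 1).
Proof.
case: z => [[|n]|n].
- by rewrite /= !bin0.
- by rewrite intS addrAC subrr add0r /= binS PoszD.
- by have -> : Negz n - 1 = Negz n.+1 by lia.
Qed.

(** Induction on [r] by Pascal's rule. Terms with $t > r$ vanish, so one bound [k] serves all rows
    of a matrix of size [k]. *)
Lemma binomz_vandermonde m r k z : (r < k)%N ->
  binomz (m + r) z = \sum_(t < k) ('C(r, t))%:Z * binomz m (z - t%:Z).
Proof.
elim: r k z => [|r IHr] [|k] z // ltrk.
  rewrite addn0 big_ord_recl big1 => [|t _]; last by rewrite bin0n mul0r.
  by rewrite bin0 mul1r subr0 addr0.
(* The sum for [z - 1] gets one term fewer: its term [t] pairs with term $t+1$ of the sum for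
   [z]. *)
rewrite addnS binomzS (IHr k.+1) ?(IHr k) ?(ltn_trans _ ltrk) //.
rewrite !big_ord_recl !bin0 -addrA -big_split /=; congr (_ + _).
apply: eq_bigr => t _; rewrite /bump /= add1n binS PoszD mulrDl.
by congr (_ + _ * binomz m _); lia.
Qed.

Lemma PD_toeplitz k i j : PD k i j = \det (toeplitz (binomz i) k j%:Z).
Proof.
(* [L] is lower unitriangular and holds the Vandermonde coefficients. *)
pose L : 'M[int]_k := \matrix_(r, t) ('C(r, t))%:Z.
have detL : \det L = 1.
  rewrite det_trig; last first.
    by apply/is_trig_mxP => r s ltrs; rewrite mxE bin_small.
  by rewrite big1 // => r _; rewrite mxE binn.
rewrite /PD -[RHS]mul1r -detL -det_mulmx; congr (\det _).
apply/matrixP => r s; rewrite !mxE.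
rewrite -[LHS]/(binomz (i + r) (j + s)%N%:Z) (binomz_vandermonde _ _ (ltn_ord r)).
by apply: eq_bigr => t _; rewrite !mxE PoszD.
Qed.

(** At $z = -1$ the first column of the Toeplitz matrix has only negative indices, so its
    determinant is 0, as the zero convention demands. The order is positive because the empty
    determinant would be 1. *)
Lemma entry_PD_toeplitz k (i : nat) (z : int) : -1 <= z ->
  entry (PD k.+1) i z = \det (toeplitz (binomz i) k.+1 z).
Proof.
case: z => [n|[|n]] // _; first exact: PD_toeplitz.
rewrite (expand_det_col _ ord0) big1 // => r _; rewrite mxE.
have -> : Negz 0 + (ord0 : 'I_k.+1)%:Z - r%:Z = Negz r by rewrite /=; lia.
by rewrite mul0r.
Qed.

Theorem theorem3p1 (k : nat) (hk : (1 <= k)%N) :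
  (forall m n : nat,
     logconc (PD k) m n =
       PD k m n ^+ 2 - entry (PD k) m (n%:Z - 1) * PD k m n.+1
     /\ PD k m n ^+ 2 - entry (PD k) m (n%:Z - 1) * PD k m n.+1 =
       PD k.-1 m n * PD k.+1 m n)
  /\ logconc (PD k) =2 hadamard (PD k.-1) (PD k.+1).
Proof.
have logconcE m n : logconc (PD k) m n =
    PD k m n ^+ 2 - entry (PD k) m (n%:Z - 1) * PD k m n.+1.
  by rewrite /logconc -PoszD addn1.
have recE m n : PD k m n ^+ 2 - entry (PD k) m (n%:Z - 1) * PD k m n.+1 =
    PD k.-1 m n * PD k.+1 m n.
  (* Since $n - 1 \ge -1$, the boundary case $n = 0$ needs no separate treatment. *)
  case: k hk {logconcE} => // k _; rewrite entry_PD_toeplitz; last by lia.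
  by rewrite !PD_toeplitz [RHS]mulrC det_toeplitz_rec -[n.+1]addn1 PoszD.
by split=> [m n | m n]; [split | rewrite logconcE recE].
Qed.
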